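(* Let $\Phi=(\phi_n)$, $\Psi=(\psi_n)$ be sequences in $\mathcal H$ and let $m=(m_n)$ be a complex scalar sequence such that $M_{m,\Phi,\Psi}$ is unconditionally convergent and invertible. If $\Psi=\Phi$, then $(\sqrt{m_n}\,\phi_n)$ is a frame for $\mathcal H$, where for each $n\in\mathbb N$, $\sqrt{m_n}$ denotes one (any one) of the two complex square roots of $m_n$; and thus there exist scalar sequences $(c_n)$ and $(d_n)$ with $m_n=c_n\overline{d_n}$ for every $n$ such that $(c_n\phi_n)$ and $(d_n\psi_n)$ are frames for $\mathcal H$.
   Context: $\mathcal H$ is a complex Hilbert space having an orthonormal basis $(e_n)_{n\in\mathbb N}$ indexed by $\mathbb N$; all sequences and sums are indexed by $\mathbb N$. The multiplier is $M_{m,\Phi,\Psi}f=\sum_{n=1}^\infty m_n\langle f,\psi_n\rangle\phi_n$, where $\langle\cdot,\cdot\rangle$ is linear in the first argument. It is unconditionally convergent if for every $f\in\mathcal H$ the series converges unconditionally (i.e. it converges for every permutation of its terms). It is invertible if the resulting linear operator $M:\mathcal H\to\mathcal H$ has a bounded operator $M^{-1}:\mathcal H\to\mathcal H$ with $MM^{-1}=M^{-1}M=I_{\mathcal H}$. A sequence $(\phi_n)$ in $\mathcal H$ is a frame for $\mathcal H$ if there are constants $0<A\le B<\infty$ with $A\|h\|^2\le\sum_n|\langle h,\phi_n\rangle|^2\le B\|h\|^2$ for all $h\in\mathcal H$. *)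

(* Defs.v *)
From mathcomp Require Import all_boot all_order all_algebra sesquilinear.
From mathcomp Require Import complex.
From mathcomp Require Import all_classical all_reals all_analysis.

Set Implicit Arguments.
Unset Strict Implicit.
Unset Printing Implicit Defensive.

Import Order.TTheory GRing.Theory Num.Theory.
Import numFieldNormedType.Exports.

Local Open Scope classical_set_scope.
Local Open Scope ring_scope.

(* The norm of a normed module over R[i] takes its values in R[i] (with zero
   imaginary part); rnorm is the same norm with values in R. It applies to
   vectors and, for V := R[i], to the modulus of scalars. *)
Definition rnorm (R : realType) (V : normedZmodType R[i]) (x : V) : R :=
  complex.Re `|x|.

(* A Hilbert space is a complete normed module H together with an inner product
   dot (linear in its first argument, conjugate-linear in the second) that
   induces the norm of H. *)
Definition induces_norm (R : realType) (H : completeNormedModType R[i])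
    (dot : {dot H for Num.conj}) : Prop :=
  forall h : H, `|h| ^+ 2 = dot h h.

Definition orthonormal_basis (R : realType) (H : completeNormedModType R[i])
    (dot : {dot H for Num.conj}) (e : nat -> H) : Prop :=
  (forall i j : nat, dot (e i) (e j) = (i == j)%:R) /\
  (forall h : H, series (fun n => dot h (e n) *: e n) @ \oo --> h).

Definition unconditionally_convergent (R : realType)
    (H : completeNormedModType R[i]) (x : nat -> H) : Prop :=
  forall sigma : nat -> nat, bijective sigma -> cvgn (series (x \o sigma)).

Definition bounded_operator (R : realType) (H : completeNormedModType R[i])
    (T : {linear H -> H}) : Prop :=
  exists C : R, forall h : H, rnorm (T h) <= C * rnorm h.

Definition invertible_operator (R : realType) (H : completeNormedModType R[i])
    (M : H -> H) : Prop :=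
  exists N : {linear H -> H},
    [/\ bounded_operator N, (forall h : H, M (N h) = h) &
        (forall h : H, N (M h) = h)].

Section Multiplier.
Context (R : realType) (H : completeNormedModType R[i]).
Context (dot : {dot H for Num.conj}).

Definition multiplier_term (m : nat -> R[i]) (phi psi : nat -> H) (f : H)
    (n : nat) : H :=
  (m n * dot f (psi n)) *: phi n.

(* limn is a junk value when the series diverges, so this is meaningful only
   for convergent multipliers. *)
Definition multiplier (m : nat -> R[i]) (phi psi : nat -> H) (f : H) : H :=
  limn (series (multiplier_term m phi psi f)).

Definition unconditionally_convergent_multiplier (m : nat -> R[i])
    (phi psi : nat -> H) : Prop :=
  forall f : H, unconditionally_convergent (multiplier_term m phi psi f).

(* The sum is extended-real: finiteness is part of the upper bound. *)
Definition frame (phi : nat -> H) : Prop :=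
  exists A B : R, 0 < A <= B /\
    forall h : H,
      ((A * rnorm h ^+ 2)%:E <=
         \sum_(0 <= n <oo) (rnorm (dot h (phi n)) ^+ 2)%:E <=
       (B * rnorm h ^+ 2)%:E)%E.

End Multiplier.

(* Main.v *)
(* For every f the series of m_n |<f, phi_n>|^2 converges in any
   order, so by Riemann's rearrangement argument sum |m_n| |<f, phi_n>|^2 is
   finite; the uniform boundedness principle turns this pointwise bound into a
   Bessel bound B for the sequence s_n phi_n, s_n^2 = m_n. Conversely, expanding
   |M f|^2 and using Cauchy-Schwarz gives
     |M f|^2 <= B * sum |<f, s_n phi_n>|^2,
   while |f| <= |M^-1| |M f|, which is the lower frame bound. Only |s_n| matters,
   so s_n may be replaced by its conjugate, which gives d. *)

Require Import Defs.
From mathcomp Require Import all_boot all_order all_algebra sesquilinear.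
From mathcomp Require Import complex.
From mathcomp Require Import all_classical all_reals all_analysis.
From mathcomp Require Import zify lra ring.

Set Implicit Arguments.
Unset Strict Implicit.
Unset Printing Implicit Defensive.

Import Order.TTheory GRing.Theory Num.Theory.
Import numFieldNormedType.Exports.
Local Open Scope ring_scope.

(** * Rearrangements of a series by finite blocks *)

Section Blocks.
Variables (l : nat -> seq nat) (g : nat -> nat).
Hypothesis g_lt : forall k, (g k < g k.+1)%N.
Hypothesis l_perm : forall k, perm_eq (l k) (iota 0 (g k)).
Hypothesis l_ext : forall k, exists t, l k.+1 = l k ++ t.

Let size_l k : size (l k) = g k.
Proof. by rewrite (perm_size (l_perm k)) size_iota. Qed.

Let g_ge k : (k <= g k)%N.
Proof. by elim: k => // k IHk; exact: leq_ltn_trans IHk (g_lt k). Qed.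

Let l_prefix j k : (j <= k)%N -> exists t, l k = l j ++ t.
Proof.
move=> jk; rewrite -(subnK jk); elim: (k - j)%N => [|d [t IHd]].
  by exists [::]; rewrite cats0.
have [u ->] := l_ext (d + j); exists (t ++ u).
by rewrite IHd catA.
Qed.

Let nth_l i j k : (i < g j)%N -> (i < g k)%N -> nth 0%N (l j) i = nth 0%N (l k) i.
Proof.
by move=> ij ik; case/orP: (leq_total j k) => /l_prefix[t ->];
  rewrite nth_cat size_l ?ij ?ik.
Qed.

(** The lists extend one another and [k <= g k], so position [i] is settled from [l i.+1] on, and
    [sigma] reads it there. Each [n] occurs in [l n.+1], which gives the right inverse [tau];
    injectivity is read off one list, long enough for both positions and free of duplicates. *)
Lemma bijective_of_blocks :
  exists2 sigma : nat -> nat, bijective sigma &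
    forall k, [seq sigma i | i <- iota 0 (g k)] = l k.
Proof.
pose sigma i := nth 0%N (l i.+1) i.
pose tau n := index n (l n.+1).
have sigmaE i k : (i < g k)%N -> sigma i = nth 0%N (l k) i.
  by move=> ik; apply: nth_l => //; exact: g_ge.
have mem_l n k : (n \in l k) = (n < g k)%N.
  by rewrite (perm_mem (l_perm k)) mem_iota add0n.
have uniq_l k : uniq (l k) by rewrite (perm_uniq (l_perm k)) iota_uniq.
exists sigma; last first.
  move=> k; apply: (@eq_from_nth _ 0%N); rewrite ?size_map ?size_iota ?size_l //.
  by move=> i ik; rewrite (nth_map 0%N) ?size_iota// nth_iota// add0n (sigmaE _ k).
have tauK : cancel tau sigma.
  move=> n; have nl : n \in l n.+1 by rewrite mem_l g_ge.
  by rewrite (sigmaE _ n.+1) ?nth_index// -size_l index_mem.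
have sigma_inj : injective sigma.
  move=> i j; rewrite (sigmaE i (maxn i j).+1) ?(sigmaE j (maxn i j).+1);
    try by (apply: leq_trans (g_ge _); rewrite ltnS ?leq_maxl ?leq_maxr).
  move/eqP; rewrite nth_uniq ?size_l//;
    try by (apply: leq_trans (g_ge _); rewrite ltnS ?leq_maxl ?leq_maxr).
  by move/eqP.
by exists tau => // i; apply: sigma_inj; rewrite tauK.
Qed.

End Blocks.

(* Otherwise cut nat into consecutive blocks on which the positive terms
   outweigh everything before them, and list each block positive terms first:
   this permutation has unbounded partial sums. *)
Lemma sum_pospart_bounded (R : archiRealDomainType) (b : nat -> R) :
  (forall sigma : nat -> nat, bijective sigma ->
     exists B, forall N, \sum_(n < N) b (sigma n) <= B) ->
  exists B, forall N, \sum_(n < N) Num.max (b n) 0 <= B.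
Proof.
move=> bdd; apply: contrapT => unb.
have next N : exists M, (N < M)%N /\
    N%:R <= \sum_(0 <= n < N) b n + \sum_(N <= n < M) Num.max (b n) 0.
  apply: contrapT => nex; apply: unb.
  (* If no [M] works, the positive parts from [N] on sum to less than [N] minus the earlier sum, so
     this constant bounds all partial sums. The last sum runs up to [N.+1] to cover [M <= N.+1]
     directly. *)
  exists (N%:R - \sum_(0 <= n < N) b n + \sum_(0 <= n < N.+1) Num.max (b n) 0).
  have pos P (m k : nat) : 0 <= \sum_(m <= n < k | P n) Num.max (b n) 0.
    by apply: sumr_ge0 => n _; rewrite le_max lexx orbT.
  have nnN : 0 <= N%:R - \sum_(0 <= n < N) b n.
    rewrite leNgt; apply/negP => neg; apply: nex; exists N.+1; split=> //.
    by have := pos xpredT N N.+1; lra.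
  move=> M; rewrite -(big_mkord xpredT (fun n => Num.max (b n) 0)).
  have [MN|NM] := leqP M N.+1.
    rewrite [X in _ <= _ + X](@big_cat_nat _ _ _ M)//=.
    by have := pos xpredT M N.+1; lra.
  have NM' : (N <= M)%N by exact: ltnW (ltnW NM).
  rewrite (@big_cat_nat _ _ _ N)//= [X in _ <= _ + X](@big_cat_nat _ _ _ N)//=.
  have := pos xpredT N N.+1.
  have [h|h] := leP N%:R (\sum_(0 <= n < N) b n + \sum_(N <= n < M) Num.max (b n) 0).
    by case: nex; exists M; split=> //; exact: ltnW.
  by lra.
have [nx /all_and2[nx_gt nx_sum]] := choice next.
pose g k := iter k nx 0%N.
pose up N := [seq n <- index_iota N (nx N) | 0 < b n].
pose down N := [seq n <- index_iota N (nx N) | ~~ (0 < b n)].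
pose l := fix l k := if k is j.+1 then l j ++ (up (g j) ++ down (g j)) else [::].
have l_perm k : perm_eq (l k) (iota 0 (g k)).
  elim: k => // k IHk; rewrite /= [X in iota _ X](_ : _ = g k + (nx (g k) - g k))%N.
    rewrite iotaD add0n; apply: perm_cat => //.
    by rewrite /up /down /index_iota perm_filterC.
  by rewrite subnKC// ltnW.
have [|||sigma sigma_bij sigmaE] := bijective_of_blocks (l := l) (g := g).
- by move=> k; exact: nx_gt.
- exact: l_perm.
- by move=> k; exists (up (g k) ++ down (g k)).
have [B sB] := bdd sigma sigma_bij.
have [k Bk] : exists k : nat, B < k%:R.
  exists (Num.bound `|B|).
  exact: le_lt_trans (ler_norm B) (archi_boundP (normr_ge0 B)).
have gk : (k <= g k)%N.
  elim: (k) => // j IHj; exact: leq_ltn_trans IHj (nx_gt (g j)).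
(* This partial sum stops right after the positive terms of block [k], where it is at least
   [g k >= k > B]. *)
have := sB (g k + size (up (g k)))%N; apply/negP; rewrite -ltNge.
apply: (lt_le_trans Bk); apply: (@le_trans _ _ (g k)%:R); first by rewrite ler_nat.
apply: (le_trans (nx_sum (g k))).
have szl j : size (l j) = g j by rewrite (perm_size (l_perm j)) size_iota.
rewrite -(big_mkord xpredT (fun n => b (sigma n))) -(big_map sigma xpredT b).
have -> : [seq sigma i | i <- index_iota 0 (g k + size (up (g k)))] = l k ++ up (g k).
  have le : (g k + size (up (g k)) <= g k.+1)%N.
    by rewrite -(szl k.+1) /= !size_cat szl leq_add2l leq_addr.
  rewrite /index_iota subn0 -(minn_idPl le) -take_iota map_take sigmaE /= catA.
  by rewrite take_size_cat// size_cat szl.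
rewrite big_cat/= (perm_big _ (l_perm k)) /index_iota subn0 lerD2l /up big_filter.
rewrite [leLHS](bigID (fun n => 0 < b n))/= [X in _ + X]big1 ?addr0.
  by apply: ler_sum => n bn; rewrite max_l// ltW.
by move=> n; rewrite -leNgt => bn; rewrite max_r.
Qed.

(** * The real-valued norm *)

Section Rnorm.
Context {R : realType}.

Lemma norm_rnormE (V : normedZmodType R[i]) (x : V) : `|x| = (rnorm x)%:C%C.
Proof. by rewrite /rnorm RRe_real// normr_real. Qed.

Lemma rnorm_ge0 (V : normedZmodType R[i]) (x : V) : 0 <= rnorm x.
Proof. by rewrite -ler0c -norm_rnormE. Qed.

Lemma rnorm0 (V : normedZmodType R[i]) : rnorm (0 : V) = 0.
Proof. by rewrite /rnorm normr0. Qed.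

Lemma rnorm0_eq0 (V : normedZmodType R[i]) (x : V) : rnorm x = 0 -> x = 0.
Proof. by move=> x0; apply/eqP; rewrite -normr_eq0 norm_rnormE x0. Qed.

Lemma rnormN (V : normedZmodType R[i]) (x : V) : rnorm (- x) = rnorm x.
Proof. by rewrite /rnorm normrN. Qed.

Lemma rnormB (V : normedZmodType R[i]) (x y : V) : rnorm (x - y) = rnorm (y - x).
Proof. by rewrite -rnormN opprB. Qed.

Lemma ler_rnormD (V : normedZmodType R[i]) (x y : V) : rnorm (x + y) <= rnorm x + rnorm y.
Proof. by rewrite -lecR rmorphD/= -!norm_rnormE ler_normD. Qed.

Lemma ler_rnorm_sum (V : normedZmodType R[i]) I (r : seq I) (x : I -> V) :
  rnorm (\sum_(i <- r) x i) <= \sum_(i <- r) rnorm (x i).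
Proof.
apply: (big_ind2 (fun y b => rnorm y <= b)) => // [|y b y' b' yb yb'].
  by rewrite rnorm0.
exact: le_trans (ler_rnormD _ _) (lerD yb yb').
Qed.

Lemma rnormM (a b : R[i]) : rnorm (a * b) = rnorm a * rnorm b.
Proof. by apply/complexI; rewrite rmorphM/= -!norm_rnormE normrM. Qed.

Lemma rnormX (a : R[i]) n : rnorm (a ^+ n) = rnorm a ^+ n.
Proof. by apply/complexI; rewrite rmorphXn/= -!norm_rnormE normrX. Qed.

Lemma rnormJ (a : R[i]) : rnorm (a^*) = rnorm a.
Proof. by apply/complexI; rewrite -!norm_rnormE norm_conjC. Qed.

Lemma rnorm_sqrC (a : R[i]) : (rnorm a ^+ 2)%:C%C = a * a^*.
Proof. by rewrite -normCK norm_rnormE rmorphXn. Qed.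

Lemma rnormR (r : R) : rnorm (r%:C%C : R[i]) = `|r|.
Proof. by rewrite /rnorm normc_def /= expr0n/= addr0 sqrtr_sqr. Qed.

Lemma rnormZ (V : normedModType R[i]) (a : R[i]) (x : V) :
  rnorm (a *: x) = rnorm a * rnorm x.
Proof. by apply/complexI; rewrite rmorphM/= -!norm_rnormE normrZ. Qed.

Lemma Re_le_rnorm (a : R[i]) : complex.Re a <= rnorm a.
Proof. by rewrite (le_trans (ler_norm _))// -lecR -norm_rnormE normc_ge_Re. Qed.

(** Multiplication by [- 'i], of modulus 1, turns the imaginary part into the real part. *)
Lemma Im_le_rnorm (a : R[i]) : complex.Im a <= rnorm a.
Proof.
have i1 : rnorm (- 'i%C : R[i]) = 1.
  by rewrite rnormN /rnorm normc_def/= expr0n expr1n add0r sqrtr1.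
rewrite -[rnorm a]mulr1 -i1 -rnormM.
by apply: le_trans (Re_le_rnorm _); case: a => a b /=; rewrite oppr0 mulr0 add0r mulrN1 opprK.
Qed.

(** The modulus is at most [|Re a| + |Im a|]; each absolute value is split into two positive parts
    because [sum_pospart_bounded] controls only those. *)
Lemma rnorm_le_pospart (a : R[i]) :
  rnorm a <= Num.max (complex.Re a) 0 + Num.max (complex.Re (- a)) 0
           + Num.max (complex.Im a) 0 + Num.max (complex.Im (- a)) 0.
Proof.
have pp (x : R) : Num.max x 0 + Num.max (- x) 0 = `|x|.
  have [h|h] := lerP 0 x.
    by rewrite max_r ?oppr_le0// addr0 ger0_norm.
  by rewrite max_l ?oppr_ge0 ?ltW// add0r ltr0_norm.
rewrite !raddfN/= -addrA !pp {1}/rnorm normc_def/=.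
rewrite -[leRHS]ger0_norm ?addr_ge0// -sqrtr_sqr ler_wsqrtr//.
rewrite sqrrD !real_normK ?num_real// -addrA (addrC (_ *+ 2)) addrA lerDl.
by rewrite mulrn_wge0// mulr_ge0.
Qed.

Lemma cvg_rnorm_lt (H : normedModType R[i]) (u : nat -> H) (l : H) (eps : R) :
  (u @ \oo --> l)%classic -> 0 < eps ->
  exists N, forall n, (N <= n)%N -> rnorm (l - u n) < eps.
Proof.
move=> /cvgrPdist_lt + eps0 => /(_ eps%:C%C); rewrite ltcR => /(_ eps0)[N _ uN].
by exists N => n Nn; rewrite -ltcR -norm_rnormE; exact: uN.
Qed.

Lemma cvg_rnorm_le (H : normedModType R[i]) (u : nat -> H) (l a : H) k (r : R) :
  (u @ \oo --> l)%classic -> (forall n, (k <= n)%N -> rnorm (u n - a) <= r) ->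
  rnorm (l - a) <= r.
Proof.
move=> ul ur; apply/ler_addgt0Pl => eps eps0.
have [N uN] := cvg_rnorm_lt ul eps0.
rewrite -(subrKA (u (maxn N k))).
apply: le_trans (ler_rnormD _ _) (lerD (ltW (uN _ _)) (ur _ _)).
  exact: leq_maxl.
exact: leq_maxr.
Qed.

Lemma cvg_rnorm_bounded (H : normedModType R[i]) (u : nat -> H) :
  cvgn u -> exists B, forall n, rnorm (u n) <= B.
Proof.
move=> /cvg_seq_bounded[M [Mreal uM]].
have M1 : M < M + 1 by rewrite ltrDl.
exists (complex.Re (M + 1)) => n.
rewrite -lecR -norm_rnormE RRe_real; last by rewrite realD.
exact: (uM _ M1 n).
Qed.

Lemma cauchy_rnorm_cvg (H : completeNormedModType R[i]) (u : nat -> H) :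
  (forall eps : R, 0 < eps -> exists N, forall n, (N <= n)%N -> rnorm (u N - u n) < eps) ->
  cvgn u.
Proof.
move=> cu; apply: cauchy_cvg; apply: cauchy_exP => e e0.
have eE : e = (complex.Re e)%:C%C by rewrite RRe_real// gtr0_real.
have [|N uN] := cu (complex.Re e); first by rewrite -ltcR -eE.
exists (u N); exists N => // n Nn /=.
by rewrite -ball_normE/= eE norm_rnormE ltcR; exact: uN.
Qed.

End Rnorm.

(** * Cauchy-Schwarz and finite sums of squared coefficients *)

Section InnerProduct.
Context {R : realType} {H : completeNormedModType R[i]} {dot : {dot H for Num.conj}}.
Hypothesis Hdot : induces_norm dot.

Lemma dotxx (x : H) : dot x x = (rnorm x ^+ 2)%:C%C.
Proof. by rewrite -Hdot norm_rnormE rmorphXn. Qed.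

Lemma dotC (x y : H) : dot x y = (dot y x)^*.
Proof. by rewrite hermC/= expr0 mul1r. Qed.

Lemma rnorm_dotC (x y : H) : rnorm (dot x y) = rnorm (dot y x).
Proof. by rewrite dotC rnormJ. Qed.

Lemma cauchy_schwarz (x y : H) : rnorm (dot x y) <= rnorm x * rnorm y.
Proof.
have [y0|y0] := eqVneq (rnorm y) 0.
  by rewrite (rnorm0_eq0 y0) linear0r !rnorm0 mulr0.
set c := dot x y.
have key (t : R) :
    rnorm (x - (t%:C%C * c) *: y) ^+ 2 =
    rnorm x ^+ 2 + t ^+ 2 * rnorm c ^+ 2 * rnorm y ^+ 2 - 2 * t * rnorm c ^+ 2.
  apply: complexI; rewrite -dotxx dnormB dnormZ !dotxx linearZr_LR/= -/c.
  have tJ : (t%:C%C)^* = t%:C%C :> R[i] by rewrite conj_Creal// complex_real.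
  have -> : (t%:C%C * c)^* * c = (t * rnorm c ^+ 2)%:C%C.
    by rewrite rmorphM/= tJ -mulrA [_ * c]mulrC -rnorm_sqrC -rmorphM.
  rewrite norm_rnormE rnormM rnormR -rmorphXn -rmorphM/= conj_Creal ?complex_real//.
  rewrite -!rmorphD -rmorphB/=; congr (_%:C)%C.
  by rewrite exprMn real_normK ?num_real//; ring.
have y_gt0 : 0 < rnorm y by rewrite lt_neqAle eq_sym y0 rnorm_ge0.
(* With [t = 1 / |y|^2] the subtracted vector is the orthogonal projection of [x] on [y]. *)
have := sqr_ge0 (rnorm (x - ((rnorm y ^- 2)%:C%C * c) *: y)).
have -> : rnorm (x - ((rnorm y ^- 2)%:C%C * c) *: y) ^+ 2 =
    rnorm x ^+ 2 - rnorm c ^+ 2 / rnorm y ^+ 2 by rewrite key; field.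
rewrite subr_ge0 ler_pdivrMr ?exprn_gt0// -exprMn ler_sqr//.
  by rewrite nnegrE rnorm_ge0.
by rewrite nnegrE mulr_ge0 ?rnorm_ge0.
Qed.

(** Partial sums of the frame series: a bound uniform in [N] replaces any statement on the infinite
    sum until the end. *)
Definition sqsum (phi : nat -> H) (N : nat) (h : H) : R :=
  \sum_(n < N) rnorm (dot h (phi n)) ^+ 2.

Lemma sqsum_ge0 phi N h : 0 <= sqsum phi N h.
Proof. by apply: sumr_ge0 => n _; rewrite sqr_ge0. Qed.

Lemma sqsumZ phi N a h : sqsum phi N (a *: h) = rnorm a ^+ 2 * sqsum phi N h.
Proof.
by rewrite /sqsum mulr_sumr; apply: eq_bigr => n _; rewrite linearZl_LR rnormM exprMn.
Qed.

Lemma parallelogram (a b : R[i]) :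
  rnorm (a + b) ^+ 2 + rnorm (a - b) ^+ 2 = 2 * (rnorm a ^+ 2 + rnorm b ^+ 2).
Proof.
apply: complexI; rewrite rmorphM !rmorphD/= !rnorm_sqrC rmorphB rmorphD/= rmorph1.
by ring.
Qed.

Lemma sqsum_parallelogram phi N x y :
  sqsum phi N (x + y) + sqsum phi N (x - y) = 2 * (sqsum phi N x + sqsum phi N y).
Proof.
rewrite /sqsum -!big_split mulr_sumr; apply: eq_bigr => n _ /=.
by rewrite linearDl linearBl/= parallelogram.
Qed.

(** Each term satisfies [|a + b|^2 >= |a|^2 - 2 |a| |b|]. This makes a large value at [x] persist on
    a small ball around [x]. *)
Lemma sqsum_lipschitz phi N x :
  exists2 L, 0 < L & forall u, sqsum phi N x - L * rnorm u <= sqsum phi N (x + u).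
Proof.
pose K := \sum_(n < N) rnorm (dot x (phi n)) * rnorm (phi n).
have K0 : 0 <= K by apply: sumr_ge0 => n _; rewrite mulr_ge0 ?rnorm_ge0.
(* The slope [2 * K] suffices; adding 1 makes it positive, so that it can be divided by. *)
exists (2 * K + 1) => [|u]; first by lra.
have : sqsum phi N x - 2 * K * rnorm u <= sqsum phi N (x + u); last first.
  by have := rnorm_ge0 u; lra.
rewrite /sqsum /K mulr_sumr mulr_suml -sumrB; apply: ler_sum => n _.
have -> : dot (x + u) (phi n) = dot x (phi n) + dot u (phi n) by rewrite linearDl.
set a := dot x _; set b := dot u _.
have ab : rnorm a <= rnorm (a + b) + rnorm b.
  by rewrite -{1}(addrK b a) -(rnormN b) ler_rnormD.
have bu : rnorm a * rnorm b <= rnorm a * (rnorm u * rnorm (phi n)).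
  by rewrite ler_wpM2l ?rnorm_ge0// cauchy_schwarz.
have a0 := rnorm_ge0 a; have b0 := rnorm_ge0 b; have s0 := rnorm_ge0 (a + b).
have : rnorm a ^+ 2 - 2 * (rnorm a * rnorm b) <= rnorm (a + b) ^+ 2; last by lra.
(* If [|a| <= |b|] the lower bound is nonpositive; otherwise [|a| - |b| <= |a + b|] may be
   squared. *)
have [le_ab|lt_ba] := leP (rnorm a) (rnorm b).
  by apply: le_trans (sqr_ge0 _); nra.
have : (rnorm a - rnorm b) ^+ 2 <= rnorm (a + b) ^+ 2.
  by rewrite ler_sqr ?nnegrE//; lra.
by have := sqr_ge0 (rnorm b); lra.
Qed.

End InnerProduct.

(** * Uniform boundedness: from pointwise bounds to a Bessel bound *)

Section Bessel.
Context {R : realType} {H : completeNormedModType R[i]} {dot : {dot H for Num.conj}}.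
Hypothesis Hdot : induces_norm dot.
Variable phi : nat -> H.
Hypothesis bounded_sqsum : forall h, exists B, forall N, sqsum (dot := dot) phi N h <= B.
Local Notation Q := (sqsum (dot := dot) phi).

(* Baire's theorem and [Banach_Steinhauss] are only available over real scalars,
   hence this direct argument by nested balls. *)
Lemma sqsum_bounded_on_ball : exists x r B, 0 < r /\
  forall y N, rnorm y <= r -> Q N (x + y) <= B.
Proof.
apply: contrapT => nbd.
(* From stage [k] and a ball, a ball of at most half the radius inside it is chosen, on which some
   [Q N] is at least [k]. Positivity of the radius is a premise inside the existential so that
   [choice] applies to all pairs. *)
have step (p : nat * (H * R)) : exists q : H * R, 0 < p.2.2 ->
    [/\ 0 < q.2, q.2 <= p.2.2 / 2, rnorm (q.1 - p.2.1) <= p.2.2 / 2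
      & exists N, forall z, rnorm (z - q.1) <= q.2 -> p.1%:R <= Q N z].
  case: p => k [x r] /=; have [r0|] := ltP 0 r; last by exists (x, r).
  have [y [N [yr Qk]]] : exists y N, rnorm y <= r / 2 /\ k%:R < Q N (x + y).
    apply: contrapT => nex; apply: nbd; exists x, (r / 2), k%:R.
    split=> [|y N yr]; first by rewrite divr_gt0.
    by rewrite leNgt; apply/negP => Qk; apply: nex; exists y, N.
  have [L L0 QL] := sqsum_lipschitz Hdot phi N (x + y).
  have d0 : 0 < (Q N (x + y) - k%:R) / L by rewrite divr_gt0// subr_gt0.
  (* The second radius is the distance at which the Lipschitz lower bound drops to [k]. *)
  exists (x + y, Num.min (r / 2) ((Q N (x + y) - k%:R) / L)) => _ /=.
  split.
  - by rewrite lt_min d0 divr_gt0.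
  - by rewrite ge_min lexx.
  - by rewrite (addrC x) addrK.
  exists N => z; rewrite le_min => /andP[_]; rewrite ler_pdivlMr// mulrC => zL.
  have := QL (z - (x + y)); rewrite (addrC (x + y)) subrK.
  by apply: le_trans; lra.
have [nx nxP] := choice step.
pose f := fix f k := if k is j.+1 then nx (j, f j) else (0 : H, 1 : R).
have r_gt0 k : 0 < (f k).2.
  by elim: k => [|k IHk] //=; have [] := nxP (k, f k) IHk.
have fP k := nxP (k, f k) (r_gt0 k).
have r_le k : (f k).2 <= (k.+1)%:R^-1.
  elim: k => [|k IHk]; first by rewrite invr1.
  have [_ + _ _] := fP k; move/le_trans; apply.
  apply: (@le_trans _ _ (k.+1%:R^-1 / 2)); first by rewrite ler_pM2r.
  by rewrite -invfM lef_pV2 ?posrE ?mulr_gt0// -natrM ler_nat; lia.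
have f_ball j k : rnorm ((f (k + j)%N).1 - (f k).1) <= (f k).2.
  elim: j k => [|j IHj] k; first by rewrite addn0 subrr rnorm0 ltW.
  have [_ r2 x2 _] := fP k.
  rewrite addnS -addSn -(subrKA (f k.+1).1).
  apply: le_trans (ler_rnormD _ _) _.
  have := IHj k.+1; move: r2 x2 => /=; lra.
have f_ball' k n : (k <= n)%N -> rnorm ((f n).1 - (f k).1) <= (f k).2.
  by move=> /subnKC <-; exact: f_ball.
have : cvgn (fun k => (f k).1).
  apply: cauchy_rnorm_cvg => eps eps0.
  exists (Num.bound eps^-1) => n Nn; rewrite rnormB.
  apply: le_lt_trans (f_ball' _ _ Nn) _; apply: le_lt_trans (r_le _) _.
  rewrite invf_plt ?posrE//; apply: lt_trans (archi_boundP _) _.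
    by rewrite invr_ge0 ltW.
  by rewrite ltr_nat.
move=> /cvg_ex[/= l fl].
(* The limit [l] lies in every ball, hence some [Q N l] is at least [k] for a [k] above its
   pointwise bound [B]. *)
have [B QB] := bounded_sqsum l.
have [_ _ _ [N /(_ l)]] := fP (Num.bound `|B|).
move=> /(_ (cvg_rnorm_le fl (f_ball' (Num.bound `|B|).+1))) /= /le_trans/(_ (QB N)).
apply/negP; rewrite -ltNge; apply: le_lt_trans (ler_norm B) _.
exact: archi_boundP.
Qed.

(** The parallelogram identity moves the bound from a ball around [x] to the ball of the same radius
    around 0, and homogeneity extends it to all vectors. *)
Lemma sqsum_bessel : exists2 B, 0 < B & forall N h, Q N h <= B * rnorm h ^+ 2.
Proof.
have [x [r [B [r0 QB]]]] := sqsum_bounded_on_ball.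
have QyB y N : rnorm y <= r -> Q N y <= B.
  move=> yr; have := sqsum_parallelogram (dot := dot) phi N x y.
  have := QB y N yr; have := QB (- y) N; rewrite rnormN => /(_ yr).
  have := sqsum_ge0 (dot := dot) phi N x; lra.
have B0 : 0 <= B by apply: le_trans (sqsum_ge0 _ _ _) (QyB 0 0%N _); rewrite rnorm0 ltW.
exists (B / r ^+ 2 + 1) => [|N h]; first by rewrite ltr_wpDl// divr_ge0// sqr_ge0.
have [h0|h0] := eqVneq (rnorm h) 0.
  have -> : h = 0 *: h by rewrite scale0r (rnorm0_eq0 h0).
  by rewrite sqsumZ rnormZ rnorm0 expr0n !mul0r expr0n mulr0.
have h_gt0 : 0 < rnorm h by rewrite lt_neqAle eq_sym h0 rnorm_ge0.
have := QyB ((r / rnorm h)%:C%C *: h) N.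
have rh0 : 0 <= r / rnorm h by rewrite divr_ge0 // ltW.
rewrite rnormZ sqsumZ rnormR (ger0_norm rh0) divfK// lexx => /(_ isT).
rewrite expr_div_n mulrAC ler_pdivrMr ?exprn_gt0// mulrC -ler_pdivlMr ?exprn_gt0//.
move=> /le_trans; apply.
by rewrite mulrDl mul1r mulrAC ler_wpDr ?sqr_ge0.
Qed.

End Bessel.

(** The four maps [Re], [- Re], [Im], [- Im] are additive and dominated by the modulus, so each
    yields a real sequence to which [sum_pospart_bounded] applies. *)
Lemma rnorm_summable (R : realType) (a : nat -> R[i]) :
  (forall sigma : nat -> nat, bijective sigma ->
     exists B, forall N, rnorm (\sum_(n < N) a (sigma n)) <= B) ->
  exists B, forall N, \sum_(n < N) rnorm (a n) <= B.
Proof.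
move=> bdd.
have part (g : R[i] -> R) : (forall z, g z <= rnorm z) -> g 0 = 0 ->
    {morph g : x y / x + y} -> exists B, forall N, \sum_(n < N) Num.max (g (a n)) 0 <= B.
  move=> g_le g0 gD; apply: (sum_pospart_bounded (b := g \o a)) => sigma /bdd[B sB].
  exists B => N; apply: le_trans (sB N); rewrite -(big_morph g gD g0).
  exact: g_le.
have [||| B1 b1] := part (fun z => complex.Re z).
- exact: Re_le_rnorm.
- by [].
- by move=> x y; rewrite raddfD.
have [||| B2 b2] := part (fun z => complex.Re (- z)).
- by move=> z; rewrite -rnormN Re_le_rnorm.
- by rewrite oppr0.
- by move=> x y; rewrite opprD raddfD.
have [||| B3 b3] := part (fun z => complex.Im z).
- exact: Im_le_rnorm.
- by [].
- by move=> x y; rewrite raddfD.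
have [||| B4 b4] := part (fun z => complex.Im (- z)).
- by move=> z; rewrite -rnormN Im_le_rnorm.
- by rewrite oppr0.
- by move=> x y; rewrite opprD raddfD.
exists (B1 + B2 + B3 + B4) => N.
have {b1 b2 b3 b4} := lerD (lerD (lerD (b1 N) (b2 N)) (b3 N)) (b4 N).
by rewrite -!big_split; apply: le_trans; apply: ler_sum => n _; exact: rnorm_le_pospart.
Qed.

(** * The two frame bounds *)

Section Frame.
Context {R : realType} {H : completeNormedModType R[i]} {dot : {dot H for Num.conj}}.
Hypothesis Hdot : induces_norm dot.
Local Notation sqsum := (sqsum (dot := dot)).

Lemma frame_of_sqsum phi B K : 0 < B -> 0 < K ->
  (forall N h, sqsum phi N h <= B * rnorm h ^+ 2) ->
  (forall h S, (forall N, sqsum phi N h <= S) -> rnorm h ^+ 2 <= K * S) ->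
  frame dot phi.
Proof.
(* The maximum secures [A <= B], which the two inequalities do not imply when [H] is zero. *)
move=> B0 K0 upper lower; exists K^-1, (Num.max B K^-1).
rewrite invr_gt0 K0 le_max lexx orbT; split=> // h.
set u := fun n => (rnorm (dot h (phi n)) ^+ 2)%:E.
have u_ge0 n : (0 <= u n)%E by rewrite lee_fin sqr_ge0.
have uE N : (\sum_(0 <= n < N) u n)%E = (sqsum phi N h)%:E.
  by rewrite big_mkord sumEFin.
have sum_le : (\sum_(0 <= n <oo) u n <= (B * rnorm h ^+ 2)%:E)%E.
  apply: lime_le; first by apply: is_cvg_nneseries.
  by apply: nearW => N; rewrite uE lee_fin.
have sum_fin : (\sum_(0 <= n <oo) u n)%E \is a fin_num.
  rewrite ge0_fin_numE; last exact: nneseries_ge0.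
  by apply: le_lt_trans sum_le _; rewrite ltry.
apply/andP; split.
  rewrite -(fineK sum_fin) lee_fin mulrC ler_pdivrMr// mulrC; apply: lower => N.
  by rewrite -lee_fin (fineK sum_fin) -uE; exact: nneseries_lim_ge.
apply: (le_trans sum_le); rewrite lee_fin ler_wpM2r ?sqr_ge0//.
by rewrite le_max lexx.
Qed.

Variables (phi : nat -> H) (m w : nat -> R[i]).
Hypothesis w_sqr : forall n, rnorm (w n) ^+ 2 = rnorm (m n).
Hypothesis Huc : unconditionally_convergent_multiplier dot m phi phi.
Let wphi n := w n *: phi n.

Lemma rnorm_dot_weighted h n :
  rnorm (dot h (wphi n)) = rnorm (w n) * rnorm (dot h (phi n)).
Proof. by rewrite rnorm_dotC linearZl_LR rnormM rnorm_dotC. Qed.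

(** Pairing the terms of [M h] with [h] gives scalars of modulus [|m_n| |<h, phi_n>|^2]. Their
    rearranged partial sums are bounded by Cauchy-Schwarz, since convergent series have bounded
    partial sums. *)
Lemma sqsum_weighted_bounded h : exists B, forall N, sqsum wphi N h <= B.
Proof.
pose a n := dot (multiplier_term dot m phi phi h n) h.
have aE n : rnorm (a n) = rnorm (dot h (wphi n)) ^+ 2.
  rewrite /a linearZl_LR !rnormM (rnorm_dotC (phi n)) rnorm_dot_weighted.
  by rewrite exprMn w_sqr -mulrA -expr2.
have [|B aB] := @rnorm_summable _ a.
  move=> sigma /(@Huc h) /cvg_rnorm_bounded[B SB].
  exists (B * rnorm h) => N; rewrite /a -linear_sumlz/=.
  apply: le_trans (cauchy_schwarz Hdot _ _) _.
  by rewrite ler_wpM2r ?rnorm_ge0//; have := SB N; rewrite /series/= big_mkord.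
by exists B => N; apply: le_trans (aB N); apply: ler_sum => n _; rewrite aE.
Qed.

(* <S_N f, S_N f> is a sum of products |<f, w_n phi_n>| |<S_N f, w_n phi_n>|,
   which AM-GM bounds by (B |.|^2 + |.|^2 / B) / 2; the Bessel bound B absorbs the
   second half. *)
Lemma series_multiplier_le B f S N : 0 < B ->
  (forall N h, sqsum wphi N h <= B * rnorm h ^+ 2) ->
  (forall N, sqsum wphi N f <= S) ->
  rnorm (series (multiplier_term dot m phi phi f) N) ^+ 2 <= B * S.
Proof.
move=> B0 upper fS; set g := series _ N.
have gg : rnorm g ^+ 2 <=
    \sum_(n < N) rnorm (dot f (wphi n)) * rnorm (dot g (wphi n)).
  have -> : rnorm g ^+ 2 = rnorm (dot g g).
    by rewrite (dotxx Hdot) rnormR ger0_norm ?sqr_ge0.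
  rewrite {1}/g /series/= big_mkord linear_sumlz/=.
  apply: le_trans (ler_rnorm_sum _ _) _; apply: ler_sum => n _.
  rewrite linearZl_LR !rnormM (rnorm_dotC (phi n)) !rnorm_dot_weighted -w_sqr.
  by rewrite mulrACA -expr2 mulrA.
have amgm : \sum_(n < N) rnorm (dot f (wphi n)) * rnorm (dot g (wphi n)) <=
    (B * sqsum wphi N f + B^-1 * sqsum wphi N g) / 2.
  rewrite /sqsum !mulr_sumr -big_split mulr_suml; apply: ler_sum => n _ /=.
  set x := rnorm _; set y := rnorm (dot g _).
  have -> : B * x ^+ 2 + B^-1 * y ^+ 2 = 2 * (x * y) + B^-1 * (B * x - y) ^+ 2.
    by field; rewrite gt_eqF.
  by rewrite ler_pdivlMr// mulrC lerDl mulr_ge0 ?sqr_ge0// invr_ge0 ltW.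
have gB : B^-1 * sqsum wphi N g <= rnorm g ^+ 2 by rewrite ler_pdivrMl.
have fB : B * sqsum wphi N f <= B * S by rewrite ler_pM2l.
lra.
Qed.

Lemma weighted_frame :
  invertible_operator (multiplier dot m phi phi) -> frame dot wphi.
Proof.
move=> [T [[C TC] _ TM]].
have [B B0 upper] := sqsum_bessel Hdot sqsum_weighted_bounded.
(* The operator bound [C] has no prescribed sign, so the positive [|C| + 1] takes its place. *)
have C0 : 0 < (`|C| + 1) ^+ 2 by rewrite exprn_gt0// ltr_wpDl.
apply: (frame_of_sqsum B0 (mulr_gt0 C0 B0) upper) => f S fS.
have MfS : rnorm (multiplier dot m phi phi f) ^+ 2 <= B * S.
  have S0 : 0 <= B * S.
    by rewrite mulr_ge0 ?(ltW B0)//; apply: le_trans (sqsum_ge0 _ _ _) (fS 0%N).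
  rewrite -(sqr_sqrtr S0) ler_sqr ?nnegrE ?rnorm_ge0 ?sqrtr_ge0//.
  rewrite -[multiplier _ _ _ _ _]subr0.
  apply: (@cvg_rnorm_le _ _ _ _ 0 0%N).
    (* The identity permutation shows that the [limn] in [multiplier] is a genuine limit. *)
    exact: (@Huc f id (Bijective (frefl _) (frefl _))).
  move=> n _; rewrite subr0 -ler_sqr ?nnegrE ?rnorm_ge0 ?sqrtr_ge0// sqr_sqrtr//.
  exact: (series_multiplier_le n B0 upper fS).
have fM : rnorm f <= (`|C| + 1) * rnorm (multiplier dot m phi phi f).
  rewrite -{1}(TM f); apply: le_trans (TC _) _.
  by rewrite ler_wpM2r ?rnorm_ge0// (le_trans (ler_norm _))// lerDl.
set Mf := rnorm _ in MfS fM.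
rewrite -mulrA; apply: (@le_trans _ _ (((`|C| + 1) * Mf) ^+ 2)).
  by rewrite ler_sqr ?nnegrE ?mulr_ge0 ?rnorm_ge0 ?addr_ge0.
by rewrite exprMn ler_pM2l.
Qed.

End Frame.

Theorem corollary4p6 (R : realType) (H : completeNormedModType R[i])
    (dot : {dot H for Num.conj}) (e : nat -> H)
    (Hdot : induces_norm dot) (He : orthonormal_basis dot e)
    (phi psi : nat -> H) (m : nat -> R[i])
    (Huc : unconditionally_convergent_multiplier dot m phi psi)
    (Hinv : invertible_operator (multiplier dot m phi psi))
    (Heq : psi = phi) :
  (forall s : nat -> R[i], (forall n : nat, s n ^+ 2 = m n) ->
     frame dot (fun n : nat => s n *: phi n)) /\
  (exists c d : nat -> R[i],
     (forall n : nat, m n = c n * Num.conj (d n)) /\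
     frame dot (fun n : nat => c n *: phi n) /\
     frame dot (fun n : nat => d n *: psi n)).
Proof.
rewrite {}Heq in Huc Hinv *.
have frame_sqrt s : (forall n, s n ^+ 2 = m n) -> frame dot (fun n => s n *: phi n).
  move=> sm; apply: (weighted_frame Hdot _ Huc Hinv) => n.
  by rewrite -rnormX sm.
split=> //; exists (fun n => sqrtc (m n)), (fun n => Num.conj (sqrtc (m n))).
split; first by move=> n; rewrite conjCK -expr2 sqr_sqrtc.
split; first by apply: frame_sqrt => n; exact: sqr_sqrtc.
(* The conjugate root squares to the conjugate of [m n], so [frame_sqrt] does not apply; its modulus
   is still the right one. *)
apply: (weighted_frame Hdot _ Huc Hinv) => n.
by rewrite rnormJ -rnormX sqr_sqrtc.
Qed.
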